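(* Let $\theta\mapsto|\Psi(\theta)\rangle\in\mathbb{C}^2\otimes\mathbb{C}^2$ be a smooth family of normalized pure two-qubit states with regular set $\mathcal{R}$, and let $\Sigma$ be a two-parameter slice through a point $p\in\mathcal{R}$, endowed with its induced support-projected Petz metric. Suppose that the concurrence, as a smooth function on the slice, satisfies $C(p)\in(0,1)$ and $\nabla C(p)\neq0$. Then there exist local slice coordinates $(u,v)$ centred at $p$ such that $$\partial_uC(p)=|\nabla C(p)|>0,\qquad \partial_vC(p)=0.$$
   Context: Petz monotone metric: let $f:(0,\infty)\to(0,\infty)$ be operator monotone with $f(t)=t f(t^{-1})$, $f(1)=1$, and $c_f(a,b)=\frac{1}{b\,f(a/b)}$ for $a,b>0$. For an invertible density matrix $\rho$ and Hermitian traceless $X,Y$, $g^{(f)}_\rho(X,Y)=\operatorname{Tr}[X\,c_f(L_\rho,R_\rho)(Y)]$, with $L_\rho(X)=\rho X$, $R_\rho(X)=X\rho$. Reduced data: $\rho_A(\theta)=\operatorname{Tr}_B|\Psi(\theta)\rangle\langle\Psi(\theta)|$, $\theta$ in an open subset of $\mathbb{R}^m$; concurrence $C(\theta)=2\sqrt{\det\rho_A(\theta)}$. Reduced Petz tensor: $F^{(f)}_{ij}(\theta)=g^{(f)}_{\rho_A(\theta)}(\partial_i\rho_A,\partial_j\rho_A)$. Regular set $\mathcal{R}$: the set of parameters at which the eigenvalues of $\rho_A(\theta)$ are bounded below by a fixed $\delta>0$ and the active (nonzero) eigenvalues of $F^{(f)}(\theta)$ form a cluster separated from the remaining (zero) eigenvalues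 by a uniform gap. Support-projected Petz metric: $g^{(f)}(\theta)=P(\theta)F^{(f)}(\theta)P(\theta)$, with $P(\theta)$ the spectral projector of $F^{(f)}(\theta)$ onto its active eigenvalue cluster. Two-parameter slice: a smooth map $\iota:\Sigma\to\mathcal{R}$ from an open set $\Sigma\subset\mathbb{R}^2$ with differential of rank $2$ everywhere, for which $g^{(f)}_\Sigma:=\iota^*g^{(f)}$ is a Riemannian metric. Slice coordinates are smooth local coordinates on $\Sigma$. The gradient $\nabla C$ and its norm $|\nabla C|$ are taken on the slice with respect to $g^{(f)}_\Sigma$. *)

(* Defs.v *)
From mathcomp Require Import all_boot all_order all_algebra.
From mathcomp Require Import complex.
From mathcomp Require Import all_classical all_reals all_analysis.

Set Implicit Arguments.
Unset Strict Implicit.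
Unset Printing Implicit Defensive.

Import Order.TTheory GRing.Theory Num.Theory.
Import numFieldNormedType.Exports.

Local Open Scope classical_set_scope.
Local Open Scope ring_scope.
Local Open Scope complex_scope.
Local Open Scope sesquilinear_scope.

(** * Smooth maps on open subsets of R^n (points are row vectors) *)

Section Smooth.
Variable R : realType.

Definition basis_vec (n : nat) (i : 'I_n) : 'rV[R]_n := delta_mx 0 i.

(* [f] is of class C^k on [U] (meant for [U] open): differentiable with partial
   derivatives of class C^(k-1), and continuous when k = 0. *)
Fixpoint Ck_on (k n : nat) (U : set 'rV[R]_n) (f : 'rV[R]_n -> R) : Prop :=
  match k with
  | 0 => forall x, U x -> {for x, continuous f}
  | k'.+1 => (forall x, U x -> differentiable f x) /\
             forall i : 'I_n, Ck_on k' U (fun x => 'D_(basis_vec i) f x)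
  end.

Definition smooth_on (n : nat) (U : set 'rV[R]_n) (f : 'rV[R]_n -> R) : Prop :=
  forall k, Ck_on k U f.

Definition smooth_map_on (n q : nat) (U : set 'rV[R]_n)
    (F : 'rV[R]_n -> 'rV[R]_q) : Prop :=
  forall j : 'I_q, smooth_on U (fun x => F x 0 j).

End Smooth.

(** * Spectral calculus *)

Section Spectral.
Variable R : realType.
Notation C := R[i].

(* [h(A)] for a Hermitian [A]: apply [h] to the (real) eigenvalues in a spectral
   decomposition of [A]. *)
Definition hermfun (n : nat) (h : R -> R) (A : 'M[C]_n) : 'M[C]_n :=
  invmx (spectralmx A)
    *m diag_mx (map_mx (fun z => (h (complex.Re z))%:C) (spectral_diag A))
    *m spectralmx A.

(* [c(L_A, R_A)(Y)] for a Hermitian [A].  If [A = V^-1 D V] with [D] diagonal,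
   the matrix units satisfy [A (V^-1 E_ij V) = d_i (V^-1 E_ij V)] and
   [(V^-1 E_ij V) A = d_j (V^-1 E_ij V)], so the joint functional calculus of the
   commuting operators [L_A], [R_A] multiplies the (i, j) component by
   [c d_i d_j]. *)
Definition lrfun (n : nat) (c : R -> R -> R) (A Y : 'M[C]_n) : 'M[C]_n :=
  let V := spectralmx A in
  let d i := complex.Re (spectral_diag A 0 i) in
  invmx V
    *m (\matrix_(i, j) ((c (d i) (d j))%:C * (V *m Y *m invmx V) i j))
    *m V.

Lemma hermfun_eigen n h (A : 'M[C]_n) (a : R) (v : 'rV[C]_n) :
  A \is hermsymmx -> v *m A = a%:C *: v -> v *m hermfun h A = (h a)%:C *: v.
Proof.
move=> /hermitian_normalmx/orthomx_spectralP; rewrite /hermfun.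
have := spectral_unit A.
set V := spectralmx A; set d := spectral_diag A => Vu eA vA.
clearbody V d.
pose w := v *m invmx V.
have wd : w *m diag_mx d = a%:C *: w.
  by rewrite /w scalemxAl -vA eA !mulmxA (mulmxK Vu).
have wh : w *m diag_mx (map_mx (fun z => (h (complex.Re z))%:C) d)
          = (h a)%:C *: w.
  clearbody w; apply/rowP => i; move/rowP/(_ i) : wd.
  rewrite !mul_mx_diag !mxE [RHS]mulrC => /eqP.
  rewrite -subr_eq0 -mulrBr mulf_eq0 subr_eq0 => /orP[/eqP ->|/eqP -> /=].
    by rewrite mul0r mulr0.
  by rewrite mulrC.
by rewrite !mulmxA -/w wh -scalemxAl /w mulmxKV.
Qed.

Lemma lrfun_eigen n c (A X : 'M[C]_n) (a b : R) :
  A \is hermsymmx -> A *m X = a%:C *: X -> X *m A = b%:C *: X ->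
  lrfun c A X = (c a b)%:C *: X.
Proof.
move=> /hermitian_normalmx/orthomx_spectralP; rewrite /lrfun.
have := spectral_unit A.
set V := spectralmx A; set d := spectral_diag A => Vu eA AX XA.
clearbody V d.
pose Y := V *m X *m invmx V.
have dY : diag_mx d *m Y = a%:C *: Y.
  by rewrite /Y scalemxAl scalemxAr -AX eA !mulmxA (mulmxV Vu) mul1mx.
have Yd : Y *m diag_mx d = b%:C *: Y.
  by rewrite /Y scalemxAl scalemxAr -XA eA !mulmxA (mulmxK Vu).
suff E : \matrix_(i, j)
    ((c (complex.Re (d 0 i)) (complex.Re (d 0 j)))%:C * Y i j)
    = (c a b)%:C *: Y.
  by rewrite -/Y E -scalemxAr -scalemxAl /Y !mulmxA (mulVmx Vu) mul1mx (mulmxKV Vu).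
clearbody Y; apply/matrixP => i j; rewrite [LHS]mxE [RHS]mxE.
move/matrixP/(_ i j) : dY; move/matrixP/(_ i j) : Yd.
rewrite mul_mx_diag mul_diag_mx.
rewrite [LHS]mxE [RHS]mxE [Y i j * _]mulrC => /eqP.
rewrite -subr_eq0 -mulrBl mulf_eq0 subr_eq0 => /orP[/eqP ->|/eqP ->]; last by rewrite !mulr0.
rewrite [LHS]mxE [RHS]mxE => /eqP.
rewrite -subr_eq0 -mulrBl mulf_eq0 subr_eq0 => /orP[/eqP ->|/eqP ->] //.
by rewrite !mulr0.
Qed.

Definition posdef (n : nat) (A : 'M[C]_n) : Prop :=
  A \is hermsymmx /\
  forall v : 'cV[C]_n, v != 0 -> 0 < (v ^t* *m A *m v) 0 0.

Definition loewner_le (n : nat) (A B : 'M[C]_n) : Prop :=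
  forall v : 'cV[C]_n, 0 <= (v ^t* *m (B - A) *m v) 0 0.

Definition operator_monotone (f : R -> R) : Prop :=
  forall (n : nat) (A B : 'M[C]_n), posdef A -> posdef B ->
    loewner_le A B -> loewner_le (hermfun f A) (hermfun f B).

(* Only the values of [f] on (0, +oo) matter. *)
Record petz_function (f : R -> R) : Prop := PetzFunction {
  petz_pos : forall t, 0 < t -> 0 < f t;
  petz_monotone : operator_monotone f;
  petz_sym : forall t, 0 < t -> f t = t * f t^-1;
  petz_norm : f 1 = 1
}.

Definition petz_c (f : R -> R) (a b : R) : R := (b * f (a / b))^-1.

Definition petz_metric (f : R -> R) (n : nat) (rho X Y : 'M[C]_n) : C :=
  \tr (X *m lrfun (petz_c f) rho Y).

(* The spectral projector onto the nonzero eigenvalues of a real symmetric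
   matrix: the indicator function of [x != 0] applied to it. *)
Definition active_projector (n : nat) (F : 'M[R]_n) : 'M[R]_n :=
  map_mx (@complex.Re R)
    (hermfun (fun x => (x != 0)%:R) (map_mx (real_complex R) F)).

End Spectral.

(** * Two-qubit pure states *)

Section TwoQubit.
Variable R : realType.
Notation C := R[i].

(* A vector of C^2 (x) C^2 is the column of its amplitudes; the amplitude of
   |a>|b> has index [mxvec_index a b]. *)
Definition ptraceB (M : 'M[C]_(2 * 2)) : 'M[C]_2 :=
  \matrix_(a, a') \sum_(b < 2) M (mxvec_index a b) (mxvec_index a' b).

Definition concurrence (rho : 'M[C]_2) : R :=
  2 * Num.sqrt (complex.Re (\det rho)).

Variable m : nat.
Implicit Types (U : set 'rV[R]_m) (Psi : 'rV[R]_m -> 'cV[C]_(2 * 2)).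
Implicit Types (theta : 'rV[R]_m) (f : R -> R).

Definition smooth_state_family U Psi : Prop :=
  [/\ open U,
      forall k, smooth_on U (fun theta => complex.Re (Psi theta k 0)),
      forall k, smooth_on U (fun theta => complex.Im (Psi theta k 0)) &
      forall theta, U theta -> (Psi theta) ^t* *m Psi theta = 1%:M].

Definition rhoA Psi theta : 'M[C]_2 :=
  ptraceB (Psi theta *m (Psi theta) ^t*).

Definition drhoA Psi (i : 'I_m) theta : 'M[C]_2 :=
  \matrix_(a, a')
    ('D_(basis_vec R i) (fun t => complex.Re (rhoA Psi t a a')) theta
     +i* 'D_(basis_vec R i) (fun t => complex.Im (rhoA Psi t a a')) theta).

(* The trace is real because [drhoA] is Hermitian and [petz_c f] is symmetric. *)
Definition petz_tensor f Psi theta : 'M[R]_m :=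
  \matrix_(i, j)
    complex.Re (petz_metric f (rhoA Psi theta) (drhoA Psi i theta)
                                               (drhoA Psi j theta)).

Definition regular_set f U Psi (delta gap : R) : set 'rV[R]_m :=
  [set theta | [/\ U theta,
     forall l : C, eigenvalue (rhoA Psi theta) l -> delta%:C <= l &
     forall x y : R, eigenvalue (petz_tensor f Psi theta) x ->
       eigenvalue (petz_tensor f Psi theta) y ->
       x != 0 -> y = 0 -> gap <= `|x - y|]].

Definition projected_petz f Psi theta : 'M[R]_m :=
  let P := active_projector (petz_tensor f Psi theta) in
  P *m petz_tensor f Psi theta *m P.

End TwoQubit.

(** * Riemannian geometry of a slice *)

Section Slice.
Variable R : realType.
Notation point := 'rV[R]_2.

(* In row-vector convention the differential of [iota] at [s] is
   [w |-> w *m jacobian iota s]. *)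
Definition pullback (m : nat) (iota : point -> 'rV[R]_m)
    (g : 'rV[R]_m -> 'M[R]_m) (s : point) : 'M[R]_2 :=
  jacobian iota s *m g (iota s) *m (jacobian iota s)^T.

Definition riemannian_metric (S : set point) (g : point -> 'M[R]_2) : Prop :=
  [/\ forall i j, smooth_on S (fun s => g s i j),
      forall s, S s -> (g s)^T = g s &
      forall s, S s -> forall w : 'rV[R]_2, w != 0 ->
        0 < (w *m g s *m w^T) 0 0].

(* Components of the gradient: [g^(ij) d_j h]. *)
Definition grad (g : point -> 'M[R]_2) (h : point -> R) (s : point) : 'rV[R]_2 :=
  (\row_j 'D_(basis_vec R j) h s) *m invmx (g s).

Definition metric_norm (g : point -> 'M[R]_2) (s : point) (w : 'rV[R]_2) : R :=
  Num.sqrt ((w *m g s *m w^T) 0 0).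

Definition slice_metric (m : nat) (f : R -> R)
    (Psi : 'rV[R]_m -> 'cV[R[i]]_(2 * 2)) (iota : point -> 'rV[R]_m) :
    point -> 'M[R]_2 :=
  pullback iota (projected_petz f Psi).

Definition two_parameter_slice (m : nat) (f : R -> R) (U : set 'rV[R]_m)
    (Psi : 'rV[R]_m -> 'cV[R[i]]_(2 * 2)) (delta gap : R)
    (S : set point) (iota : point -> 'rV[R]_m) : Prop :=
  [/\ open S,
      smooth_map_on S iota,
      forall s, S s -> regular_set f U Psi delta gap (iota s),
      forall s, S s -> \rank (jacobian iota s) = 2 &
      riemannian_metric S (slice_metric f Psi iota)].

(* Smooth coordinates [phi = (u, v)] on the open neighbourhood [V] of [s] in
   [S], centred at [s], with image [W] and inverse [psi]. *)
Definition centred_chart (S : set point) (s : point) (V W : set point)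
    (phi psi : point -> point) : Prop :=
  [/\ [/\ open V, V `<=` S, V s & phi s = 0],
      open W,
      (forall x, V x -> W (phi x) /\ psi (phi x) = x),
      (forall y, W y -> V (psi y) /\ phi (psi y) = y) &
      smooth_map_on V phi /\ smooth_map_on W psi].

End Slice.

(* Main.v *)
Require Import Defs.
From HB Require Import structures.
From mathcomp Require Import all_boot all_order all_algebra.
From mathcomp Require Import complex.
From mathcomp Require Import all_classical all_reals all_analysis.
Import Order.TTheory GRing.Theory Num.Theory.
Import numFieldNormedType.Exports.
Local Open Scope classical_set_scope.
Local Open Scope ring_scope.

(** An affine chart suffices.  The concurrence is differentiable at [s0]: it is
    [2 sqrt (det rhoA)] with [det rhoA] a polynomial in the amplitudes that is
    positive there.  Let [D] be its differential at [s0], [G = D g^-1] its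
    gradient and [N = |G|]; then [D(G) = N^2], so [w = G / N] satisfies
    [D(w) = N > 0].  Complete [w] to a basis [(w, w')] with [D(w') = 0] and
    take [psi (u, v) = s0 + u w + v w']. *)

Set Implicit Arguments.
Unset Strict Implicit.

(** * Calculus of affine maps on row vectors *)

Section Calculus.
Variable R : realType.

(** [F] is a finite sum of scalar coordinate functions times fixed basis vectors, so coordinatewise
    differentiability suffices. *)
Lemma differentiable_rV (V : normedModType R) n (F : V -> 'rV[R]_n) x :
  (forall j, differentiable (fun y => F y 0 j) x) -> differentiable F x.
Proof.
move=> dF.
have -> : F = \sum_(j < n) (fun y => F y 0 j *: basis_vec R j).
  by apply/funext => y; rewrite fct_sumE; exact: row_sum_delta.
by apply: differentiable_sum => j; exact: differentiableZl.
Qed.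

Lemma differentiable_mulmxr n q (B : 'M[R]_(n, q)) (x : 'rV[R]_n) :
  differentiable (fun y : 'rV[R]_n => y *m B) x.
Proof.
have -> : (fun y : 'rV[R]_n => y *m B)
    = \sum_(i < n) (fun y : 'rV[R]_n => y 0 i *: row i B).
  by apply/funext => y; rewrite fct_sumE mulmx_sum_row.
by apply: differentiable_sum => i; exact/differentiableZl/differentiable_coord.
Qed.

(** A continuous linear map is its own differential, and the constant [c] contributes zero. *)
Lemma is_diff_affine n q (c : 'rV[R]_q) (B : 'M[R]_(n, q)) (x : 'rV[R]_n) :
  is_diff x (fun y => c + y *m B) (mulmxr B).
Proof.
have dB : is_diff x (mulmxr B : 'rV_n -> 'rV_q) (mulmxr B).
  have cB : continuous (mulmxr B : 'rV_n -> 'rV_q).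
    by move=> y; exact/differentiable_continuous/differentiable_mulmxr.
  by apply: DiffDef; [exact: linear_differentiable|rewrite diff_lin].
have := is_diffD (is_diff_cst c x) dB.
by rewrite add0r.
Qed.

Lemma is_derive_affine_coord n q (c : 'rV[R]_q) (B : 'M[R]_(n, q))
    (x v : 'rV[R]_n) (j : 'I_q) :
  is_derive x v (fun y => (c + y *m B) 0 j) ((v *m B) 0 j).
Proof.
pose L (y : 'rV[R]_n) : R := (y *m B) 0 j.
(* [L] is bundled as a linear map so that [diff_lin] applies to it. *)
have linL : linear L by move=> a u w; rewrite /L mulmxDl -scalemxAl !mxE.
pose lL := GRing.isLinear.Build _ _ _ _ _ linL.
pose L' : {linear 'rV[R]_n -> R} := HB.pack L lL.
have dL1 y : differentiable L y.
  apply: (@differentiable_comp _ _ _ _ (fun z => z *m B) (fun z => z 0 j)).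
    exact: differentiable_mulmxr.
  exact: differentiable_coord.
have cL : continuous L' by move=> y; exact/differentiable_continuous/dL1.
have dL : is_derive x v L (L v).
  apply: DeriveDef; first exact/diff_derivable.
  rewrite deriveE //.
  by rewrite (@diff_lin _ _ _ L').
have := is_deriveD (is_derive_cst (c 0 j) x v) dL.
rewrite add0r; congr (is_derive _ _ _ _).
by apply/funext => y; rewrite /L /= mxE.
Qed.

Lemma Ck_on_cst k n (U : set 'rV[R]_n) (a : R) : Ck_on k U (fun=> a).
Proof.
elim: k a => [|k IH] a /=; first by move=> x _; exact: cst_continuous.
split=> [x _|i]; first exact: differentiable_cst.
suff -> : (fun x => 'D_(basis_vec R i) (fun=> a) x) = fun=> 0 by exact: IH.
by apply/funext => x; exact: derive_cst.
Qed.

(** The first partial derivatives are constant, so all higher orders reduce to [Ck_on_cst]. *)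
Lemma smooth_affine n q (U : set 'rV[R]_n) (c : 'rV[R]_q) (B : 'M[R]_(n, q)) :
  smooth_map_on U (fun x => c + x *m B).
Proof.
have dj j x : differentiable (fun y : 'rV[R]_n => (c + y *m B) 0 j) x.
  apply: (@differentiable_comp _ _ _ _ (fun y => c + y *m B) (fun z => z 0 j)).
    by have [] := is_diff_affine c B x.
  exact: differentiable_coord.
move=> j [|k] /=; first by move=> x _; exact/differentiable_continuous/dj.
split=> [x _|i]; first exact: dj.
suff -> : (fun x => 'D_(basis_vec R i) (fun y : 'rV[R]_n => (c + y *m B) 0 j) x)
  = fun=> (basis_vec R i *m B) 0 j by exact: Ck_on_cst.
apply/funext => x; have dx := is_derive_affine_coord c B x (basis_vec R i) j.
exact: derive_val.
Qed.

(** The chart is defined on all of [S]; its image is the preimage of [S] under the inverse map,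
    hence open by continuity. *)
Lemma affine_chart (S : set 'rV[R]_2) (s0 : 'rV[R]_2) (B : 'M[R]_2) :
  open S -> S s0 -> B \in unitmx ->
  centred_chart S s0 S ((fun y => s0 + y *m B) @^-1` S)
    (fun x => - (s0 *m invmx B) + x *m invmx B) (fun y => s0 + y *m B).
Proof.
move=> oS Ss0 Bu.
have phiK x : s0 + (- (s0 *m invmx B) + x *m invmx B) *m B = x.
  by rewrite -mulNmx -mulmxDl mulmxKV // addrA subrr add0r.
have psiK y : - (s0 *m invmx B) + (s0 + y *m B) *m invmx B = y.
  by rewrite -mulNmx -mulmxDl addrA addNr add0r mulmxK.
split.
- by split=> //; rewrite addNr.
- apply: open_comp => // y _; apply: differentiable_continuous.
  by have [] := is_diff_affine s0 B y.
- by move=> x Sx; rewrite /= phiK.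
- by move=> y Wy; rewrite psiK.
- by split; exact: smooth_affine.
Qed.

(** Chain rule at the origin, which the affine map sends to [c]: the basis vector of index [i] is
    carried to [row i B], so the rows of [B] are the directions in which [h] is differentiated. *)
Lemma is_derive_comp_affine n q (h : 'rV[R]_q -> R) (c : 'rV[R]_q)
    (B : 'M[R]_(n, q)) (i : 'I_n) :
  differentiable h c ->
  is_derive (0 : 'rV[R]_n) (basis_vec R i) (fun y => h (c + y *m B))
    ((row i B *m (\row_j 'D_(basis_vec R j) h c)^T) 0 0).
Proof.
move=> dh.
have dA := is_diff_affine c B 0.
have [dpsi _] := dA.
have E : c + 0 *m B = c by rewrite mul0mx addr0.
have dh' : differentiable h (c + 0 *m B) by rewrite E.
apply: DeriveDef.
  by apply: diff_derivable; exact: (differentiable_comp dpsi).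
rewrite deriveE; last exact: (differentiable_comp dpsi).
rewrite (_ : (fun y => _) = h \o (fun y => c + y *m B)) //.
rewrite diff_comp // diff_val /= E /basis_vec -rowE.
(* Expanding the direction in the standard basis turns the differential into a combination of
   partial derivatives. *)
rewrite [X in 'd h c X]row_sum_delta linear_sum /= mxE; apply: eq_bigr => j _.
by rewrite linearZ /= !mxE deriveE.
Qed.

End Calculus.

(** * Real differentiability of complex-valued functions and of the concurrence *)

Section ComplexDifferentiable.
Variables (R : realType) (V : normedModType R).
Local Notation C := R[i]%C.

(** Differentiability is taken over the reals: the parameter space is real, and the entries of
    [rhoA] involve complex conjugation, which is not holomorphic. *)
Definition cdifferentiable (h : V -> C) (x : V) : Prop :=
  differentiable (fun y => complex.Re (h y)) x /\
  differentiable (fun y => complex.Im (h y)) x.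

Lemma cdifferentiable_cst (a : C) x : cdifferentiable (fun=> a) x.
Proof. by split; exact: differentiable_cst. Qed.

Lemma cdifferentiableD (h k : V -> C) x :
  cdifferentiable h x -> cdifferentiable k x ->
  cdifferentiable (fun y => h y + k y) x.
Proof.
move=> [h1 h2] [k1 k2]; split.
  rewrite (_ : (fun y => _) = (fun y => complex.Re (h y)) + (fun y => complex.Re (k y))).
    exact: differentiableD.
  by apply/funext => y; rewrite !fctE; case: (h y) => a b; case: (k y).
rewrite (_ : (fun y => _) = (fun y => complex.Im (h y)) + (fun y => complex.Im (k y))).
  exact: differentiableD.
by apply/funext => y; rewrite !fctE; case: (h y) => a b; case: (k y).
Qed.

Lemma cdifferentiableM (h k : V -> C) x :
  cdifferentiable h x -> cdifferentiable k x ->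
  cdifferentiable (fun y => h y * k y) x.
Proof.
move=> [h1 h2] [k1 k2]; split.
  rewrite (_ : (fun y => _) =
    (fun y => complex.Re (h y)) * (fun y => complex.Re (k y)) -
    (fun y => complex.Im (h y)) * (fun y => complex.Im (k y))).
    by apply: differentiableB; exact: differentiableM.
  by apply/funext => y /=; rewrite !fctE /=; case: (h y) => a b; case: (k y).
rewrite (_ : (fun y => _) =
  (fun y => complex.Re (h y)) * (fun y => complex.Im (k y)) +
  (fun y => complex.Im (h y)) * (fun y => complex.Re (k y))).
  by apply: differentiableD; exact: differentiableM.
by apply/funext => y /=; rewrite !fctE /=; case: (h y) => a b; case: (k y).
Qed.

Lemma cdifferentiable_conj (h : V -> C) x :
  cdifferentiable h x -> cdifferentiable (fun y => Num.conj (h y)) x.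
Proof.
move=> [h1 h2]; split.
  rewrite (_ : (fun y => _) = (fun y => complex.Re (h y))) //.
  by apply/funext => y; case: (h y).
rewrite (_ : (fun y => _) = - (fun y => complex.Im (h y))).
  exact: differentiableN.
by apply/funext => y; rewrite fctE; case: (h y).
Qed.

Lemma cdifferentiable_sum (I : Type) (r : seq I) (F : I -> V -> C) x :
  (forall i, cdifferentiable (F i) x) ->
  cdifferentiable (fun y => \sum_(i <- r) F i y) x.
Proof.
move=> dF; elim: r => [|i r IH].
  by under eq_fun do rewrite big_nil; exact: cdifferentiable_cst.
by under eq_fun do rewrite big_cons; exact: cdifferentiableD.
Qed.

Lemma cdifferentiable_prod (I : Type) (r : seq I) (F : I -> V -> C) x :
  (forall i, cdifferentiable (F i) x) ->
  cdifferentiable (fun y => \prod_(i <- r) F i y) x.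
Proof.
move=> dF; elim: r => [|i r IH].
  by under eq_fun do rewrite big_nil; exact: cdifferentiable_cst.
by under eq_fun do rewrite big_cons; exact: cdifferentiableM.
Qed.

(** By the Leibniz formula the determinant is a polynomial in the entries. *)
Lemma cdifferentiable_det n (A : V -> 'M[C]_n) x :
  (forall i j, cdifferentiable (fun y => A y i j) x) ->
  cdifferentiable (fun y => \det (A y)) x.
Proof.
move=> dA; apply: cdifferentiable_sum => s.
apply: cdifferentiableM; first exact: cdifferentiable_cst.
exact: cdifferentiable_prod.
Qed.

Lemma differentiable_concurrence (rho : V -> 'M[C]_2) x :
  (forall i j, cdifferentiable (fun y => rho y i j) x) ->
  0 < concurrence (rho x) -> differentiable (fun y => concurrence (rho y)) x.
Proof.
(* Positive concurrence forces a positive radicand, away from the point where the square root fails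
   to be differentiable. *)
move=> drho; rewrite /concurrence pmulr_rgt0 // sqrtr_gt0 => det0.
have [ddet _] := cdifferentiable_det drho.
rewrite (_ : (fun y => _) = 2 *: (Num.sqrt \o (fun y => complex.Re (\det (rho y))))) //.
apply: differentiableZ; apply: differentiable_comp => //.
by apply/derivable1_diffP; have [] := is_derive1_sqrt det0.
Qed.

End ComplexDifferentiable.

Lemma cdifferentiable_rhoA (R : realType) m (U : set 'rV[R]_m)
    (Psi : 'rV[R]_m -> 'cV[R[i]%C]_(2 * 2)) theta i j :
  smooth_state_family U Psi -> U theta ->
  cdifferentiable (fun t => rhoA Psi t i j) theta.
Proof.
move=> [_ sRe sIm _] Ut.
have dPsi k : cdifferentiable (fun t => Psi t k 0) theta.
  (* Class C^1 is the lowest order whose definition contains differentiability. *)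
  by split; [have [/(_ _ Ut)] := sRe k 1%N|have [/(_ _ Ut)] := sIm k 1%N].
rewrite (_ : (fun t => _) = fun t => \sum_(b < 2)
    Psi t (mxvec_index i b) 0 * Num.conj (Psi t (mxvec_index j b) 0)).
  apply: cdifferentiable_sum => b; apply: cdifferentiableM => //.
  exact: cdifferentiable_conj.
apply/funext => t; rewrite mxE; apply: eq_bigr => b _.
by rewrite !mxE big_ord1 !mxE.
Qed.

(** Chain rule through [iota]: slice points land in the regular set, hence in [U], where the
    amplitudes are smooth. *)
Lemma differentiable_slice_concurrence (R : realType) (f : R -> R) m
    (U : set 'rV[R]_m) (Psi : 'rV[R]_m -> 'cV[R[i]%C]_(2 * 2)) (delta gap : R)
    (S : set 'rV[R]_2) (iota : 'rV[R]_2 -> 'rV[R]_m) (s : 'rV[R]_2) :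
  smooth_state_family U Psi ->
  two_parameter_slice f U Psi delta gap S iota -> S s ->
  0 < concurrence (rhoA Psi (iota s)) ->
  differentiable (fun t => concurrence (rhoA Psi (iota t))) s.
Proof.
move=> sPsi [_ siota reg _ _] Ss C0.
have [Us _ _] := reg s Ss.
apply: (@differentiable_comp _ _ _ _ iota (fun t => concurrence (rhoA Psi t))).
  by apply: differentiable_rV => j; have [/(_ _ Ss)] := siota j 1%N.
by apply: differentiable_concurrence => // i j; exact: cdifferentiable_rhoA Us.
Qed.

(** * Linear algebra of the metric and of the frame *)

(** A nonzero row vector in the kernel would have a vanishing quadratic form. *)
Lemma unitmx_of_pos (F : numFieldType) n (g : 'M[F]_n) :
  (forall w : 'rV[F]_n, w != 0 -> 0 < (w *m g *m w^T) 0 0) -> g \in unitmx.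
Proof.
move=> gpos; rewrite -row_free_unit -kermx_eq0; apply/rowV0P => w /sub_kermxP wg.
by apply/eqP/negPn/negP => /gpos; rewrite wg mul0mx mxE ltxx.
Qed.

Lemma frame_completion (F : fieldType) (D w : 'rV[F]_2) :
  (w *m D^T) 0 0 != 0 ->
  exists B : 'M[F]_2, [/\ B \in unitmx, row 0 B = w & row 1 B *m D^T = 0].
Proof.
move=> wD.
(* The second row is [D] turned by a right angle: it is annihilated by [D], and the determinant of
   the matrix is exactly the pairing of [w] with [D]. *)
exists (\matrix_(i, j) if i == 0 then w 0 j else if j == 0 then - D 0 1 else D 0 0).
have l01 : lift 0 0 = 1 :> 'I_2 by exact: val_inj.
rewrite !mxE !big_ord_recl big_ord0 !mxE addr0 l01 in wD.
split.
- rewrite unitmxE unitfE (expand_det_row _ 0) !big_ord_recl big_ord0 /cofactor.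
  rewrite !det_mx11 !mxE /= l01 /= addn0 expr0 mul1r addr0.
  by rewrite (_ : (0 + _)%N = 1%N) // expr1 mulN1r opprK.
- by apply/rowP => j; rewrite !mxE.
- apply/rowP => j; rewrite ord1 !mxE !big_ord_recl big_ord0 !mxE /= l01.
  by rewrite addr0 mulNr mulrC addNr.
Qed.

(** * Construction of the adapted chart *)

Unset Implicit Arguments.
Set Strict Implicit.

Theorem lemma4p1 (R : realType) (f : R -> R) (m : nat)
    (U : set 'rV[R]_m) (Psi : 'rV[R]_m -> 'cV[R[i]%C]_(2 * 2))
    (delta gap : R) (S : set 'rV[R]_2) (iota : 'rV[R]_2 -> 'rV[R]_m)
    (p : 'rV[R]_m) (s0 : 'rV[R]_2) :
  petz_function f ->
  smooth_state_family U Psi ->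
  0 < delta -> 0 < gap ->
  regular_set f U Psi delta gap p ->
  two_parameter_slice f U Psi delta gap S iota ->
  S s0 -> iota s0 = p ->
  let C := fun s : 'rV[R]_2 => concurrence (rhoA Psi (iota s)) in
  let g := slice_metric f Psi iota in
  0 < C s0 < 1 ->
  grad g C s0 != 0 ->
  exists (V W : set 'rV[R]_2) (phi psi : 'rV[R]_2 -> 'rV[R]_2),
    [/\ centred_chart S s0 V W phi psi,
        0 < metric_norm g s0 (grad g C s0),
        is_derive (0 : 'rV[R]_2) (basis_vec R 0) (fun y => C (psi y))
          (metric_norm g s0 (grad g C s0)) &
        is_derive (0 : 'rV[R]_2) (basis_vec R 1) (fun y => C (psi y)) 0].
Proof.
move=> _ sPsi _ _ _ slice Ss0 _ C g /andP[C0 _] G0.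
have [oS _ _ _ [_ _ gpos]] := slice.
have dC : differentiable C s0 := differentiable_slice_concurrence sPsi slice Ss0 C0.
set G := grad g C s0 in G0 *; set N := metric_norm g s0 G.
pose D := \row_j 'D_(basis_vec R j) C s0.
have gu : g s0 \in unitmx by apply: unitmx_of_pos; exact: gpos.
have Gpos := gpos s0 Ss0 G G0.
have N0 : 0 < N by rewrite sqrtr_gt0.
have GD : (G *m D^T) 0 0 = N ^+ 2.
  (* Invertibility of [g s0] gives back [D] from [G], so the squared norm is the entry of
     [D *m G^T]; transposing this one-by-one matrix swaps the factors. *)
  rewrite sqr_sqrtr ?(ltW Gpos) // (_ : G *m g s0 = D); last exact: mulmxKV.
  by rewrite -[D *m _]trmxK trmx_mul trmxK [RHS]mxE.
pose w := N^-1 *: G.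
have wD : (w *m D^T) 0 0 = N.
  by rewrite -scalemxAl mxE GD expr2 mulrA mulVf ?gt_eqF // mul1r.
have [|B [Bu B0 B1]] := @frame_completion _ D w; first by rewrite wD gt_eqF.
exists S, ((fun y => s0 + y *m B) @^-1` S),
  (fun x => - (s0 *m invmx B) + x *m invmx B), (fun y => s0 + y *m B).
split=> //; first exact: affine_chart.
  (* The two partial derivatives are the pairings of the rows of [B] with [D]: [N] for the
     normalized gradient, zero for the completing vector. *)
  by have := is_derive_comp_affine B 0 dC; rewrite B0 wD.
by have := is_derive_comp_affine B 1 dC; rewrite B1 mxE.
Qed.
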